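(* Let $f(x_1,\dots,x_n)=x_1+g(x_2,x_3,\dots,x_n)$ be in $\varOmega$, i.e. $f$ is the feedback function of an $n$-stage feedback shift register all of whose cycles have lengths dividing $n+1$. Then: (1) $g(x_2,x_3,\dots,x_n)$ is symmetric. (2) Either $g_k=0$ for all odd $k$ and $g_k=1$ for all even $k$, or $g_k=1$ for all odd $k$ and $g_k=0$ for all even $k$ (where $0\le k\le n-1$).
   Context: $F_2$ is the field with two elements, and $+$ between Boolean values is addition modulo 2. The $n$-stage feedback shift register (FSR) with feedback function $f:F_2^n\to F_2$ has state set $F_2^n$ and next-state operator $\rho(a_1,\dots,a_n)=(a_2,\dots,a_n,f(a_1,\dots,a_n))$. Only nonsingular feedback functions are considered, i.e. those of the form $f=x_1+g(x_2,\dots,x_n)$ with $g$ a Boolean function of $n-1$ variables. A cycle of length (period) $l$ is a cyclic sequence of $l$ distinct states, each mapped by $\rho$ to the next and the last mapped to the first. $\varOmega$ denotes the class of $n$-stage FSRs (identified with their feedback functions) such that the periods of all cycles are factors of $n+1$. A Boolean function is symmetric if it is invariant under every permutation of its variables. $g_k$ denotes the restriction of $g$ to the set of inputs $x\in F_2^{n-1}$ of Hamming weight $wt(x)=k$; ''$g_k=c$'' means this restriction is constantly equal to $c$. *)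

(* Defs.v *)
From mathcomp Require Import all_boot all_order all_algebra all_fingroup.

Set Implicit Arguments.
Unset Strict Implicit.
Unset Printing Implicit Defensive.

Import GRing.Theory.
Local Open Scope ring_scope.

Definition boolfun (n : nat) := n.-tuple 'F_2 -> 'F_2.

(* An FSR has at least one stage, so the number of stages is written m.+1
   throughout; g then has m variables. *)
Definition next_state (m : nat) (f : boolfun m.+1) (a : m.+1.-tuple 'F_2) :
    m.+1.-tuple 'F_2 :=
  [tuple of rcons (behead_tuple a) (f a)].

(* x_1 + g (x_2, ..., x_n) *)
Definition feedback (m : nat) (g : boolfun m) : boolfun m.+1 :=
  fun x => thead x + g (behead_tuple x).

Definition nonsingular (m : nat) (f : boolfun m.+1) : Prop :=
  exists g : boolfun m, f =1 feedback g.

(* The empty sequence is an [fcycle] in the library, hence the explicit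
   exclusion; any rotation of a cycle again satisfies the predicate. *)
Definition is_cycle (m : nat) (f : boolfun m.+1)
    (c : seq (m.+1.-tuple 'F_2)) : bool :=
  [&& c != [::], uniq c & fcycle (next_state f) c].

(* n = m.+1 stages, so n + 1 = m.+2. *)
Definition Omega (m : nat) (f : boolfun m.+1) : Prop :=
  nonsingular f /\ forall c, is_cycle f c -> (size c %| m.+2)%N.

Definition symmetric_boolfun (n : nat) (g : boolfun n) : Prop :=
  forall (s : 'S_n) (x : n.-tuple 'F_2), g [tuple tnth x (s i) | i < n] = g x.

Definition wt (n : nat) (x : n.-tuple 'F_2) : nat := count_mem (1 : 'F_2) x.

(* The assertion "g_k = c". *)
Definition constant_on_weight (n : nat) (g : boolfun n) (k : nat) (c : 'F_2) :
    Prop :=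
  forall x : n.-tuple 'F_2, wt x = k -> g x = c.

(* Main.v *)
Require Import Defs.
From mathcomp Require Import all_boot all_order all_algebra all_fingroup.

Set Implicit Arguments.
Unset Strict Implicit.
Unset Printing Implicit Defensive.

Import GRing.Theory.
Local Open Scope ring_scope.

(** The invariant behind the theorem is [g y + \sum_i y_i], which turns out to
    be constant; hence [f] is the sum of all its variables, up to a constant.

    Since all periods divide n + 1, each output sequence u satisfies
    u_(k+n+1) = u_k ([next_state_periodic]), so the sum of n + 1 consecutive
    outputs does not depend on where it starts.  For a state [a] this sum is
    [\sum_i a_i + f a]; in it the variable x_1 occurs twice and cancels, which
    leaves the invariant evaluated at (a_2, ..., a_n).  Thus the invariant takes
    the same value at (a_2, ..., a_n) and at (a_3, ..., a_n, f a)
    ([feedback_sum_next]).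

    As a_1 is free and enters [f] linearly, the bit [f a] may be prescribed
    independently of a_2, ..., a_n.  Prescribing 0 at each step shifts zeros
    in until the input is the zero vector ([feedback_sum_const]), so
    [g y] is [g 0] plus the weight of [y] modulo 2; both claims follow. *)

Lemma addF2_self (x : 'F_2) : x + x = 0.
Proof. by apply: addrr_pchar2; rewrite pchar_Fp. Qed.

(** The feedback is linear in the variable that is shifted out, which is
    therefore determined by the next state. *)
Lemma next_state_inj m (f : boolfun m.+1) :
  nonsingular f -> injective (next_state f).
Proof.
move=> [g fE] a b /(congr1 val) /= /rcons_inj [ab].
rewrite !fE /feedback.
have -> : behead_tuple a = behead_tuple b by apply: val_inj.
move=> /addIr hab.
by rewrite (tuple_eta a) (tuple_eta b) hab; apply: val_inj; rewrite /= ab.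
Qed.

(** As the next-state operator is injective, the orbit of [a] closes up at [a]
    and is therefore a cycle of the register, of length dividing n + 1. *)
Lemma next_state_periodic m (f : boolfun m.+1) (a : m.+1.-tuple 'F_2) :
  Omega f -> iter m.+2 (next_state f) a = a.
Proof.
move=> [f_ns f_per]; have rho_inj := next_state_inj f_ns.
have /f_per : is_cycle f (fingraph.orbit (next_state f) a).
  by rewrite /is_cycle orbit_uniq cycle_orbit // -size_eq0 size_orbit -lt0n
             fingraph.order_gt0.
rewrite size_orbit => /dvdnP[q ->].
elim: q => // q IHq.
by rewrite mulSn iterD IHq iter_order.
Qed.

Lemma nth_iter_next_state m (f : boolfun m.+1) (a : m.+1.-tuple 'F_2) k j :
  (k + j <= m)%N -> nth 0 (iter k (next_state f) a) j = nth 0 a (k + j).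
Proof.
elim: k j => // k IHk j le_kj_m.
have lt_j_m : (j < m)%N by apply: leq_trans le_kj_m; rewrite addSn ltnS leq_addl.
by rewrite iterS nth_rcons size_tuple lt_j_m nth_behead IHk ?addnS.
Qed.

(** The bit fed in when leaving the state [next_state f a] reaches the front of
    the register m steps later, that is n + 1 steps after [a] itself, when the
    register is back in state [a]. *)
Lemma feedback_next_state m (f : boolfun m.+1) (a : m.+1.-tuple 'F_2) :
  Omega f -> f (next_state f a) = thead a.
Proof.
move=> f_Omega; set b := iter 2 (next_state f) a.
have -> : f (next_state f a) = nth 0 b m.
  by rewrite nth_rcons size_tuple ltnn eqxx.
have aE : iter m (next_state f) b = a.
  by rewrite -iterD addn2 next_state_periodic.
by rewrite -[in RHS]aE /thead (tnth_nth 0) [RHS]nth_iter_next_state /= addn0.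
Qed.

Definition feedback_sum m (g : boolfun m) (y : m.-tuple 'F_2) : 'F_2 :=
  g y + \sum_(x <- y) x.

Lemma big_thead m (a : m.+1.-tuple 'F_2) :
  \sum_(x <- a) x = thead a + \sum_(x <- behead_tuple a) x.
Proof. by rewrite {1}(tuple_eta a) big_cons. Qed.

(** The right-hand side is the sum of the n + 1 consecutive output bits that
    start in state [a]; the variable x_1 occurs in it twice and cancels. *)
Lemma feedback_sum_behead m (g : boolfun m) (a : m.+1.-tuple 'F_2) :
  feedback_sum g (behead_tuple a) = \sum_(x <- a) x + feedback g a.
Proof.
rewrite /feedback_sum /feedback big_thead.
by rewrite addrACA addF2_self add0r addrC.
Qed.

Lemma feedback_sum_next m (g : boolfun m) (a : m.+1.-tuple 'F_2) :
  Omega (feedback g) ->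
  feedback_sum g (behead_tuple (next_state (feedback g) a)) =
  feedback_sum g (behead_tuple a).
Proof.
move=> g_Omega; rewrite !feedback_sum_behead feedback_next_state //.
by rewrite big_rcons big_thead addrC addrA.
Qed.

Definition shift_zero m (y : m.-tuple 'F_2) : m.-tuple 'F_2 :=
  [tuple of behead (rcons y 0)].

Lemma nth_iter_shift_zero m (y : m.-tuple 'F_2) k j :
  nth 0 (iter k (@shift_zero m) y) j = nth 0 y (k + j).
Proof.
(* The bit shifted in equals the default value of [nth], so [j] is unbounded. *)
elim: k j => // k IHk j.
by rewrite iterS nth_behead nth_rcons_default IHk addnS.
Qed.

(** Starting from (c, y) with c = g y, the bit fed in is 0. *)
Lemma feedback_sum_shift_zero m (g : boolfun m) (y : m.-tuple 'F_2) :
  Omega (feedback g) -> feedback_sum g (shift_zero y) = feedback_sum g y.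
Proof.
move=> g_Omega; pose a := [tuple of g y :: y].
have ay : behead_tuple a = y by apply: val_inj.
have fa0 : feedback g a = 0 by rewrite /feedback ay theadE addF2_self.
rewrite -[in RHS]ay -(feedback_sum_next a g_Omega).
by congr feedback_sum; apply: val_inj; rewrite /= fa0.
Qed.

Lemma feedback_sum_const m (g : boolfun m) (y : m.-tuple 'F_2) :
  Omega (feedback g) -> feedback_sum g y = g [tuple of nseq m 0].
Proof.
move=> g_Omega.
have shiftE k : feedback_sum g (iter k (@shift_zero m) y) = feedback_sum g y.
  by elim: k => // k IHk; rewrite iterS feedback_sum_shift_zero.
have y0 : iter m (@shift_zero m) y = [tuple of nseq m 0].
  apply: eq_from_tnth => i; rewrite !(tnth_nth 0) nth_iter_shift_zero.
  by rewrite nth_nseq ltn_ord nth_default // size_tuple leq_addr.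
rewrite -(shiftE m) y0 /feedback_sum big1_seq ?addr0 // => x /andP[_].
by rewrite mem_nseq => /andP[_ /eqP].
Qed.

Lemma sumF2_wt m (y : m.-tuple 'F_2) : \sum_(x <- y) x = (wt y)%:R.
Proof.
rewrite /wt; elim: (tval y) => [|x s IHs]; first by rewrite big_nil.
rewrite big_cons IHs /= natrD; congr (_ + _).
by case: x => [[|[|//]] lt_x]; apply: val_inj.
Qed.

Lemma wt_perm m (s : 'S_m) (y : m.-tuple 'F_2) :
  wt [tuple tnth y (s i) | i < m] = wt y.
Proof.
rewrite /wt; apply: seq.permP.
by apply/tuple_permP; exists s.
Qed.

Lemma natrF2_odd k : k%:R = (odd k)%:R :> 'F_2.
Proof.
by rewrite -[in LHS](odd_double_half k) natrD -addnn natrD addF2_self addr0.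
Qed.

Theorem theorem1 (m : nat) (f : boolfun m.+1) (g : boolfun m)
    (f_def : f =1 feedback g) (f_Omega : Omega f) :
  symmetric_boolfun g /\
  (((forall k : nat, (k <= m)%N -> odd k -> constant_on_weight g k 0) /\
    (forall k : nat, (k <= m)%N -> ~~ odd k -> constant_on_weight g k 1))
   \/
   ((forall k : nat, (k <= m)%N -> odd k -> constant_on_weight g k 1) /\
    (forall k : nat, (k <= m)%N -> ~~ odd k -> constant_on_weight g k 0))).
Proof.
have g_Omega : Omega (feedback g).
  split=> [|c cyc_c]; first by exists g.
  apply: f_Omega.2; move: cyc_c; rewrite /is_cycle => /and3P[-> -> cyc_c].
  rewrite -(@eq_fcycle _ (next_state (feedback g))) // => a.
  by apply: val_inj; rewrite /= f_def.
have gE y : g y = g [tuple of nseq m 0] + (wt y)%:R.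
  rewrite -(feedback_sum_const y g_Omega) /feedback_sum -addrA sumF2_wt.
  by rewrite addF2_self addr0.
split=> [s y|]; first by rewrite gE [RHS]gE wt_perm.
case: (g _) gE => [[|[|//]] lt_c] gE; [right | left];
  by split=> k _ odd_k y wt_y; rewrite gE wt_y natrF2_odd ?odd_k ?(negbTE odd_k);
     apply: val_inj.
Qed.
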